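(* For a given defining polynomial $f$ of the extension $L/K$ (with root $\theta$), and a given choice of uniformizer $\pi$ and of sets of representatives $\mathcal{R}_d$, there is a unique triangular reduced integral basis of $L/K$ in reduced normal form.
   Context: $v\colon K\to\mathbb{Z}\cup\{\infty\}$ is a (normalized) discrete valuation on a field $K$, with valuation ring $A$, uniformizer $\pi\in A$ and maximal ideal $\mathfrak{m}=\pi A$. $L=K(\theta)$ is a finite extension of $K$ of degree $n>1$, where $\theta$ is a root of a monic irreducible polynomial $f\in A[x]$ of degree $n$. $B\subset L$ is the integral closure of $A$ in $L$, assumed to be finitely generated as an $A$-module. An integral basis of $L/K$ is an $A$-basis of $B$. $w_1,\dots,w_t$ are the valuations on $L$ extending $v$, and $w\colon L\to\mathbb{Q}\cup\{\infty\}$ is defined by $w(\alpha)=\min\{w_i(\alpha)\mid 1\le i\le t\}$. A subset $\{\alpha_1,\dots,\alpha_d\}\subset L^*$ is called reduced if $w\left(\sum_{j=1}^d a_j\alpha_j\right)=\min\{w(a_j\alpha_j)\mid 1\le j\le d\}$ for all $a_1,\dots,a_d\in K$. For $0\le j<n$, $\delta_j=\max\{w(g(\theta))\mid g\in A[x]\text{ monic of degree }j\}$; one has $\delta_0\le\cdots\le\delta_{n-1}$. The triangular reduced integral bases considered are those of the form $$\mathcal{B}=\{1,\ g_1(\theta)/\pi^{\lfloor\delta_1\rfloor},\dots,g_{n-1}(\theta)/\pi^{\lfloor\delta_{n-1}\rfloor}\},$$ where $g_0=1,g_1,\dots,g_{n-1}\in A[x]$ are monic with $\deg g_j=j$ and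 $w(g_j(\theta))=\delta_j$ for $0\le j<n$. (It is known that, for monic $g_j\in A[x]$ of degree $j$, the condition $w(g_j(\theta))=\delta_j$ for all $j$ is equivalent to this set being a reduced integral basis.) For each positive integer $d$, $\mathcal{R}_d\subset A$ is a fixed set of representatives of the classes modulo $\mathfrak{m}^d$; also $\mathcal{R}_0=\{0\}$. Let $T=(t_{ij})_{1\le i,j\le n}$ be the upper unitriangular matrix over $A$ whose rows encode $g_{n-1},\dots,g_0$, that is, $g_{n-i}=\sum_{j=1}^n t_{ij}x^{n-j}$. The basis $\mathcal{B}$ is in reduced normal form if $t_{ij}\in\mathcal{R}_{\lceil\delta_{n-i}-\delta_{n-j}\rceil}$ for all $i<j$. *)

(* Defs.v *)
From mathcomp Require Import all_boot all_order all_algebra all_field.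
From mathcomp Require Import boolp classical_sets constructive_ereal.
Set Implicit Arguments.
Unset Strict Implicit.
Unset Printing Implicit Defensive.
Import Order.TTheory GRing.Theory Num.Theory.
Local Open Scope classical_set_scope.
Local Open Scope ring_scope.

(* Additively written valuations; [\bar G] also contains [-oo], which is
   excluded as a value. *)
Definition is_valuation (G : realDomainType) (F : fieldType)
    (u : F -> \bar G) : Prop :=
  [/\ forall x, u x <> -oo%E,
      forall x, u x = +oo%E <-> x = 0,
      forall x y, u (x * y) = (u x + u y)%E
    & forall x y, (Order.min (u x) (u y) <= u (x + y)%R)%E].

Definition is_normalized_discrete_valuation (K : fieldType)
    (v : K -> \bar int) : Prop :=
  is_valuation v /\ (forall k : int, exists x : K, v x = k%:E).

Definition valring (K : fieldType) (v : K -> \bar int) : {pred K} :=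
  [pred x | (0 <= v x)%E].

Definition valideal (K : fieldType) (v : K -> \bar int) : {pred K} :=
  [pred x | (0 < v x)%E].

Definition is_uniformizer (K : fieldType) (v : K -> \bar int) (pi : K) : Prop :=
  pi \in valring v /\
  (forall x, x \in valideal v <-> exists2 a, a \in valring v & x = pi * a).

(* Congruence modulo the ideal m^d = pi^d A. *)
Definition eqmod_pow (K : fieldType) (v : K -> \bar int) (pi : K) (d : nat)
    (x y : K) : Prop :=
  exists2 a, a \in valring v & x - y = pi ^+ d * a.

Definition representatives (K : fieldType) (v : K -> \bar int) (pi : K)
    (Rep : nat -> set K) : Prop :=
  Rep 0%N = [set 0] /\
  (forall d, (0 < d)%N ->
     (forall r, Rep d r -> r \in valring v) /\
     (forall a, a \in valring v -> exists! r, Rep d r /\ eqmod_pow v pi d a r)).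

Section Extension.

Variables (K : fieldType) (L : fieldExtType K) (v : K -> \bar int).

Definition integral_closure : set L :=
  [set x | exists p : {poly K},
     [/\ p \is monic, p \is a polyOver (valring v)
       & root (map_poly (in_alg L) p) x]].

Definition fg_over_valring (M : set L) : Prop :=
  exists s : seq L, (forall i : 'I_(size s), M s`_i) /\
    (forall x, M x -> exists a : 'I_(size s) -> K,
       (forall i, a i \in valring v) /\
       x = \sum_(i < size s) a i *: s`_i).

Definition is_integral_basis (d : nat) (b : 'I_d -> L) : Prop :=
  [/\ forall i, integral_closure (b i),
      forall x, integral_closure x -> exists a : 'I_d -> K,
        (forall i, a i \in valring v) /\ x = \sum_i a i *: b i
    & forall a : 'I_d -> K, (forall i, a i \in valring v) ->
        \sum_i a i *: b i = 0 -> forall i, a i = 0].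

Definition extends (u : L -> \bar rat) : Prop :=
  forall x : K, u (in_alg L x) = er_map intr (v x).

Definition lists_extensions (t : nat) (ws : 'I_t -> L -> \bar rat) : Prop :=
  forall u : L -> \bar rat,
    (is_valuation u /\ extends u) <-> (exists i, ws i = u).

Definition minval (t : nat) (ws : 'I_t -> L -> \bar rat) (x : L) : \bar rat :=
  \big[Order.min/+oo%E]_(i < t) ws i x.

Definition is_reduced (w : L -> \bar rat) (d : nat) (alpha : 'I_d -> L) : Prop :=
  (forall j, alpha j != 0) /\
  (forall a : 'I_d -> K,
     w (\sum_j a j *: alpha j) =
     \big[Order.min/+oo%E]_(j < d) w (a j *: alpha j)).

Variables (w : L -> \bar rat) (theta : L).

Definition evalL (g : {poly K}) : L := (map_poly (in_alg L) g).[theta].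

Definition monic_over_valring (j : nat) (g : {poly K}) : Prop :=
  [/\ g \is monic, g \is a polyOver (valring v) & size g = j.+1].

Definition is_max_value (j : nat) (d : rat) : Prop :=
  (exists2 g, monic_over_valring j g & w (evalL g) = d%:E) /\
  (forall g, monic_over_valring j g -> (w (evalL g) <= d%:E)%E).

(* The maximum, with the junk value 0 where there is none. *)
Definition delta (j : nat) : rat := xget 0 [set d | is_max_value j d].

Variables (pi : K) (n : nat).

Definition triangular_reduced_integral_basis (g : 'I_n -> {poly K})
    (b : 'I_n -> L) : Prop :=
  [/\ is_integral_basis b, is_reduced w b,
      forall j : 'I_n, monic_over_valring j (g j),
      forall j : 'I_n, w (evalL (g j)) = (delta j)%:E
    & forall j : 'I_n, b j = pi ^ (- Num.floor (delta j)) *: evalL (g j)].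

(* With 0-based indices, row [i] holds the coefficients of the polynomial of
   degree [rev_ord i = n - i - 1], and column [j] those of ['X^(rev_ord j)]. *)
Definition coef_matrix (g : 'I_n -> {poly K}) : 'M[K]_n :=
  \matrix_(i, j) (g (rev_ord i))`_(rev_ord j).

(* Since delta is nondecreasing, the ceilings below are nonnegative, so that
   [absz] only casts them to [nat]. *)
Definition reduced_normal_form (Rep : nat -> set K) (g : 'I_n -> {poly K}) : Prop :=
  forall i j : 'I_n, (i < j)%N ->
    Rep (absz (Num.ceil (delta (rev_ord i) - delta (rev_ord j))))
        (coef_matrix g i j).

End Extension.

(* Main.v *)
Require Import Defs.
From mathcomp Require Import all_boot all_order all_algebra all_field.
From mathcomp Require Import boolp classical_sets constructive_ereal.
From mathcomp Require Import ring lra zify.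
Import Order.TTheory GRing.Theory Num.Theory.
Local Open Scope ring_scope.

(** Let [w] be the minimum of the valuations extending [v], and for each [j < n]
    let [g j] be monic of degree [j] over [A] with [w (g j (theta))] as large as
    possible, that is, equal to [delta j].

    Two facts about [w] carry everything. First, [w x >= 0] exactly when [x] is
    integral over [A] ([integral_closureP]). The difficult half is that an [x]
    which is not integral has a negative value under some extension of [v]:
    such an [x] does not lie in [A[1/x]], so Chevalley's theorem
    ([exists_valuation_ring]) gives a valuation ring of [L] that contains
    [A[1/x]] but not [x]. It meets [K] in [A], and since [L] is finite over [K]
    the power [y ^ (n!)] of any nonzero [y] is a unit of that ring times a power
    of [pi] ([value_exists]); this defines a rational valuation. Secondly, [w]
    takes values in [1/n! Z], and it is bounded on monic polynomials of degree
    less than [n] because [B] is finitely generated ([gauge_bounded]), so the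
    maxima [delta j] are attained.

    Maximality alone makes the [g j (theta)] reduced ([gauge_sum]): if the value
    of a combination exceeded the minimum over its terms, then dividing by the
    coefficient of the last term attaining that minimum would produce a monic
    polynomial over [A] of some degree [j] and of value above [delta j]. Hence
    the coefficients of an integral element along the [g j (theta)] have value
    at least [- delta j], and rescaling by powers of [pi] gives an integral
    basis ([triangular_basis_integral]).

    The normal form is then Gaussian reduction. One may subtract [c * g i] from
    [g j], for [i < j], keeping its value maximal, when
    [v c >= delta j - delta i]; this moves the coefficient of degree [i] freely
    in its class modulo [pi ^ ceil (delta j - delta i)]
    ([normal_polynomial_exists]). Conversely, if [h] and [h'] are both normal of
    degree [j], then reducedness bounds the leading coefficient of [h - h'],
    of degree [i] say, by the same ceiling ([gauge_le_lead]); so the two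
    coefficients of degree [i] are congruent representatives, hence equal, a
    contradiction unless [h = h'] ([normal_polynomial_unique]). *)

Set Implicit Arguments.
Unset Strict Implicit.
Unset Printing Implicit Defensive.

(** * Valuations and valuation rings *)

Section ValuationFacts.

Variables (G : realDomainType) (F : fieldType) (u : F -> \bar G).
Hypothesis hu : is_valuation u.

Lemma valuation_fin x : x != 0 -> exists k, u x = k%:E.
Proof.
case: hu => nNy y0 _ _ x0; case E: (u x) => [k| |]; first by exists k.
- by move/y0: E => E; rewrite E eqxx in x0.
- by case: (nNy x).
Qed.

Lemma valuation0 : u 0 = +oo%E.
Proof. by case: hu => _ y0 _ _; apply/y0. Qed.

Lemma valuationM x y : u (x * y) = (u x + u y)%E.
Proof. by case: hu. Qed.

Lemma valuation1 : u 1 = 0%:E.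
Proof.
have [k E] := valuation_fin (oner_neq0 F).
have := valuationM 1 1; rewrite mul1r E -EFinD => -[/eqP].
by rewrite -subr_eq0 opprD addNKr oppr_eq0 => /eqP ->.
Qed.

Lemma valuationX x k m : u x = k%:E -> u (x ^+ m) = (k *+ m)%:E.
Proof.
move=> E; elim: m => [|m IH]; first by rewrite expr0 valuation1 mulr0n.
by rewrite exprS valuationM IH E -EFinD mulrS.
Qed.

Lemma valuationV x k : u x = k%:E -> u x^-1 = (- k)%:E.
Proof.
move=> E; have x0 : x != 0 by apply/eqP => x0; rewrite x0 valuation0 in E.
have [l El] := valuation_fin (invr_neq0 x0).
have := valuationM x x^-1; rewrite divff // valuation1 E El -EFinD => -[/esym/eqP].
by rewrite addrC addr_eq0 => /eqP ->.
Qed.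

Lemma valuationXz x k (m : int) : u x = k%:E -> u (x ^ m) = (k *~ m)%:E.
Proof.
move=> E; case: m => m; first by rewrite -exprnP (valuationX _ E).
by rewrite NegzE -exprnN (valuationV (valuationX _ E)) mulrNz.
Qed.

Lemma valuationN x : u (- x) = u x.
Proof.
suff E : u (-1) = 0%:E by rewrite -mulN1r valuationM E add0e.
have n0 : (-1 : F) != 0 by rewrite oppr_eq0 oner_neq0.
have [k E] := valuation_fin n0; rewrite E; congr EFin; apply/eqP.
have := valuationM (-1) (-1); rewrite mulrNN mulr1 valuation1 E -EFinD => -[/esym/eqP].
by rewrite -mulr2n mulrn_eq0.
Qed.

Lemma valuation_minD x y : (Order.min (u x) (u y) <= u (x + y)%R)%E.
Proof. by case: hu. Qed.

End ValuationFacts.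

(** Subrings are classical sets because Zorn's lemma is applied to them. *)
Definition subring (F : fieldType) (S : set F) : Prop :=
  [/\ S 1, forall x y, S x -> S y -> S (x - y)
    & forall x y, S x -> S y -> S (x * y)].

Definition valuation_ring (F : fieldType) (S : set F) : Prop :=
  subring S /\ forall x, x != 0 -> S x \/ S x^-1.

Definition unit_in (F : fieldType) (S : set F) (x : F) : Prop := S x /\ S x^-1.

Section Subrings.

Variables (F : fieldType) (S : set F).
Hypothesis hS : subring S.

Lemma subring1 : S 1. Proof. by case: hS. Qed.

Lemma subringM x y : S x -> S y -> S (x * y).
Proof. by case: hS => _ _; apply. Qed.

Lemma subringB x y : S x -> S y -> S (x - y).
Proof. by case: hS => _ + _; apply. Qed.

Lemma subring0 : S 0.
Proof. by rewrite -(subrr 1); apply: subringB; apply: subring1. Qed.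

Lemma subringN x : S x -> S (- x).
Proof. by move=> Sx; rewrite -sub0r; apply: subringB => //; apply: subring0. Qed.

Lemma subringD x y : S x -> S y -> S (x + y).
Proof. by move=> Sx Sy; rewrite -[y]opprK; apply/subringB/subringN. Qed.

Lemma subringX x m : S x -> S (x ^+ m).
Proof.
move=> Sx; elim: m => [|m IH]; first by rewrite expr0; apply: subring1.
by rewrite exprS; apply: subringM.
Qed.

Lemma subring_sum (I : Type) (r : seq I) (P : pred I) (z : I -> F) :
  (forall i, P i -> S (z i)) -> S (\sum_(i <- r | P i) z i).
Proof.
move=> h; elim/big_ind : _ => //; [exact: subring0 | exact: subringD].
Qed.

Lemma unit_inM x y : unit_in S x -> unit_in S y -> unit_in S (x * y).
Proof. by move=> [a b] [c d]; split; rewrite ?invfM; apply: subringM. Qed.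

Lemma unit_inV x : unit_in S x -> unit_in S x^-1.
Proof. by move=> [a b]; split; rewrite ?invrK. Qed.

Lemma unit_inX x m : unit_in S x -> unit_in S (x ^+ m).
Proof. by move=> [a b]; split; rewrite -?exprVn; apply: subringX. Qed.

Definition adjoin (z : F) : set F :=
  [set t | exists2 p : {poly F}, (forall i, S p`_i) & t = p.[z]]%classic.

Lemma adjoin_subring z : subring (adjoin z).
Proof.
split.
- exists 1; last by rewrite hornerC.
  by move=> i; rewrite coef1; case: eqP => _; [apply: subring1 | apply: subring0].
- move=> _ _ [p hp ->] [q hq ->]; exists (p - q); last by rewrite hornerD hornerN.
  by move=> i; rewrite coefB; apply: subringB.
- move=> _ _ [p hp ->] [q hq ->]; exists (p * q); last by rewrite hornerM.
  by move=> i; rewrite coefM; apply: subring_sum => j _; apply: subringM.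
Qed.

Lemma sub_adjoin z : (S `<=` adjoin z)%classic.
Proof.
move=> x Sx; exists x%:P; last by rewrite hornerC.
by move=> i; rewrite coefC; case: eqP => _ //; apply: subring0.
Qed.

Lemma mem_adjoin z : adjoin z z.
Proof.
exists 'X; last by rewrite hornerX.
by move=> i; rewrite coefX; case: eqP => _; [apply: subring1 | apply: subring0].
Qed.

End Subrings.

Lemma val_ring_valuation_ring (G : realDomainType) (F : fieldType)
    (u : F -> \bar G) :
  is_valuation u -> valuation_ring [set x | 0 <= u x]%classic%E.
Proof.
move=> hu; split; first split => /=.
- by rewrite (valuation1 hu).
- move=> x y ux uy; apply: le_trans (valuation_minD hu _ _).
  by rewrite valuationN // le_min ux.
- by move=> x y ux uy; rewrite valuationM //; apply: adde_ge0.
- move=> x x0 /=; have [k E] := valuation_fin hu x0; rewrite (valuationV hu E) E !lee_fin.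
  by rewrite oppr_ge0; apply/orP/le_total.
Qed.

(** * Chevalley's extension theorem *)

(** [V] stands for a subring that is maximal among those that contain [x^-1]
    but not [x]; maximality enters through [Vmax]. *)
Section MaximalSubring.

Variables (F : fieldType) (x : F) (V : set F).
Hypothesis (hV : subring V) (Vx' : V x^-1) (nVx : ~ V x).
Hypothesis Vmax : forall z, ~ V z -> adjoin V z x.

Let y := x^-1.

Let x0 : x != 0.
Proof. by apply/eqP => x0; apply: nVx; rewrite x0; apply: subring0. Qed.

(** Maximality puts [x^-1] in the Jacobson radical: were [1 - b / x] not
    invertible in [V], then [x] would be a polynomial in its inverse, and
    clearing denominators would put [x] in [V]. *)
Lemma maximal_jacobson b : V b -> unit_in V (1 - y * b).
Proof.
move=> Vb; set s := 1 - y * b.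
have Vs : V s by apply: subringB; [|apply: subring1|apply: subringM].
split=> //; apply: contrapT => /Vmax [p hp xE].
have s0 : s != 0.
  apply/eqP => /eqP; rewrite subr_eq0 => /eqP E; apply: nVx.
  by rewrite -[x]mulr1 E mulrA divff // mul1r.
pose d := size p.
have Vxs : V (x * s ^+ d).
  rewrite xE horner_coef mulr_suml; apply: subring_sum => // i _.
  rewrite -mulrA; apply: subringM => //.
  have -> : s ^+ d = s ^+ (d - i) * s ^+ i.
    by rewrite -exprD subnK // ltnW // /d ltn_ord.
  by rewrite exprVn mulrC mulfK ?expf_neq0 //; apply: subringX.
have [b' Vb' E] : exists2 b', V b' & s ^+ d = 1 - y * b'.
  elim: (d) => [|m [c Vc E]].
    by exists 0; [apply: subring0 | rewrite mulr0 subr0].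
  exists (b * s ^+ m + c); last by rewrite exprS {1}/s mulrBl E; ring.
  by apply: subringD => //; apply: subringM => //; apply: subringX.
apply: nVx; rewrite -[x](subrK b'); apply: subringD => //.
by move: Vxs; rewrite E mulrBr mulrA divff // mul1r mulr1.
Qed.

(** If neither [z] nor [z^-1] lies in [V], then [x] is a polynomial in each of
    them. Of two such expressions, the one of lower degree serves to remove the
    top term of the other, so the total degree descends for ever. *)
Lemma maximal_no_relation m (z : F) (p q : {poly F}) :
  (size p + size q < m)%N -> (forall i, V p`_i) -> (forall i, V q`_i) ->
  x = p.[z] -> x = q.[z^-1] -> False.
Proof.
elim: m => // m IH in z p q *.
wlog le_qp : z p q / (size q <= size p)%N.
  move=> W lt_m hp hq xp xq; case: (leqP (size q) (size p)) => [le|/ltnW le].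
    exact: (W z p q).
  by apply: (W z^-1 q p) => //; rewrite ?invrK // addnC.
move=> lt_m hp hq xp xq.
have [z0|z0] := eqVneq z 0.
  by apply: nVx; rewrite xp z0 horner_coef0.
case: (posnP (size p)) => [/eqP sp|sp_gt0].
  apply: nVx; rewrite xp; move: sp; rewrite size_poly_eq0 => /eqP ->.
  by rewrite horner0; apply: subring0.
pose d := (size p).-1; have spE : size p = d.+1 by rewrite prednK.
pose s := 1 - y * q`_0.
have [Vs Vs'] : unit_in V s by apply: maximal_jacobson.
have s0 : s != 0.
  apply/eqP => /eqP; rewrite subr_eq0 => /eqP E; apply: nVx.
  by rewrite -[x]mulr1 E mulrA divff // mul1r.
(* Replacing the top term of [p] by means of
   [1 = x^-1 * \sum_(i >= 1) (q_i / s) / z ^ i]. *)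
pose p' := \poly_(j < d) (p`_j + p`_d * (y * (q`_(d - j) / s))).
apply: (IH z p' q) => //.
- by apply: leq_ltn_trans (_ : (d + size q < m)%N);
    rewrite ?leq_add2r ?size_poly //; rewrite spE in lt_m.
- move=> i; rewrite coef_poly; case: ifP => _; last exact: subring0.
  by apply: subringD => //; do !apply: subringM => //.
have xs : x - q`_0 = x * s by rewrite /s mulrBr mulr1 mulrA divff // mul1r.
have qE : \sum_(j < d) q`_(d - j) * z ^+ j = z ^+ d * (x * s).
  rewrite -xs xq (@horner_coef_wide _ d.+1); last by rewrite -spE.
  rewrite big_ord_recl expr0 mulr1 addrC addKr mulr_sumr.
  rewrite (reindex_inj rev_ord_inj) /=; apply: eq_bigr => i _.
  have lt := ltn_ord i; rewrite subKn // mulrCA exprVn; congr (_ * _).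
  have -> : z ^+ d = z ^+ (d - i.+1) * z ^+ i.+1 by rewrite -exprD subnK.
  by rewrite mulfK // expf_neq0.
rewrite horner_poly; under eq_bigr do rewrite mulrDl.
rewrite big_split /=.
have -> : \sum_(i < d) p`_d * (y * (q`_(d - i) / s)) * z ^+ i =
          p`_d * (y / s) * \sum_(j < d) q`_(d - j) * z ^+ j.
  by rewrite mulr_sumr; apply: eq_bigr => i _; ring.
rewrite qE [LHS]xp (@horner_coef_wide _ d.+1) ?spE // big_ord_recr /=; congr (_ + _).
by rewrite /y; field; apply/andP; split.
Qed.

Lemma maximal_valuation_ring : valuation_ring V.
Proof.
split=> // z z0; case: (pselect (V z)) => [|/Vmax [p hp xp]]; first by left.
case: (pselect (V z^-1)) => [|/Vmax [q hq xq]]; first by right.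
by case: (maximal_no_relation (ltnSn _) hp hq xp xq).
Qed.

End MaximalSubring.

(** A subring that contains [x^-1] but not [x], and is maximal for this, is a
    valuation ring. *)
Lemma exists_valuation_ring (F : fieldType) (S : set F) (x : F) :
  subring S -> S x^-1 -> ~ S x ->
  exists V, [/\ valuation_ring V, (S `<=` V)%classic & ~ V x].
Proof.
move=> hS Sx' nSx.
pose good V := [/\ subring V, (S `<=` V)%classic & ~ V x].
(* The empty set is adjoined because Zorn's lemma also asks for the union of
   the empty chain. *)
pose P := [set V : set F | V = set0 \/ good V]%classic.
have [FF FP tot|V [PV Vmax]] := @Zorn_bigcup F P.
  have [[V0 FV0 gV0]|no] := pselect (exists2 V, FF V & good V); last first.
    left; rewrite -subset0 => z [V FV Vz].
    case: (FP _ FV) => [V0|gV]; first by rewrite V0 in Vz.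
    by case: no; exists V.
  have two a b : (\bigcup_(X in FF) X)%classic a -> (\bigcup_(X in FF) X)%classic b ->
      exists V, [/\ FF V, good V, V a & V b].
    move=> [A FA Aa] [B FB Bb].
    have gA : good A by case: (FP _ FA) => // A0; rewrite A0 in Aa.
    have gB : good B by case: (FP _ FB) => // B0; rewrite B0 in Bb.
    by case: (tot _ _ FA FB) => sub; [exists B | exists A]; split=> //; apply: sub.
  right; split.
  - split.
    + by exists V0 => //; case: gV0 => [/subring1].
    + move=> a b Ua Ub; have [V [FV gV Va Vb]] := two _ _ Ua Ub.
      by exists V => //; case: gV => hV _ _; apply: subringB.
    + move=> a b Ua Ub; have [V [FV gV Va Vb]] := two _ _ Ua Ub.
      by exists V => //; case: gV => hV _ _; apply: subringM.
  - by move=> a Sa; exists V0 => //; case: gV0 => _ sub _; apply: sub.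
  - by move=> Ux; have [V [_ [_ _ nVx] Vx _]] := two _ _ Ux Ux.
have gV : good V.
  case: PV => // V0; case: (Vmax S); last by right; split.
  by rewrite V0; split=> // /(_ _ (subring1 hS)).
case: (gV) => hV SV nVx; exists V; split=> //.
apply: (@maximal_valuation_ring _ x) => //; first exact: SV.
move=> z nVz; apply: contrapT => nx; apply: (Vmax (adjoin V z)).
  split; last by move=> /(_ _ (mem_adjoin hV z)).
  exact: sub_adjoin.
right; split=> //; first exact: adjoin_subring.
by move=> a /SV Va; apply: sub_adjoin.
Qed.

Section ValuationRingFacts.

Variables (F : fieldType) (V : set F).
Hypothesis hV : valuation_ring V.
Let sV : subring V := hV.1.

(** Divisibility in [V] is a total preorder on nonzero elements, so a finite
    nonempty family has an element dividing all the others. *)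
Lemma valuation_ring_minimal (I : eqType) (z : I -> F) (s : seq I) :
  (forall i, i \in s -> z i != 0) -> s != [::] ->
  exists2 i, i \in s & forall j, j \in s -> V (z j / z i).
Proof.
elim: s => // a s IH z0 _; have za : z a != 0 by apply: z0; rewrite inE eqxx.
have Vaa : V (z a / z a) by rewrite divff //; apply: subring1.
have [->|s0] := eqVneq s [::].
  by exists a; rewrite ?inE // => j; rewrite inE => /eqP ->.
have [|i si min_i] := IH _ s0.
  by move=> i si; apply: z0; rewrite inE si orbT.
have zi : z i != 0 by apply: z0; rewrite inE si orbT.
have [Vai|] := hV.2 (z a / z i) (mulf_neq0 za (invr_neq0 zi)).
  exists i; first by rewrite inE si orbT.
  by move=> j; rewrite inE => /orP[/eqP ->|/min_i].
rewrite invf_div => Via; exists a; first by rewrite inE eqxx.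
move=> j; rewrite inE => /orP[/eqP -> //|/min_i Vji].
have -> : z j / z a = (z j / z i) * (z i / z a) by rewrite mulrA divfK.
exact: subringM.
Qed.

(** On [V], this is membership in the maximal ideal. *)
Definition nonunit (x : F) : Prop := x = 0 \/ ~ V x^-1.

Lemma nonunitD x y : nonunit x -> nonunit y -> nonunit (x + y).
Proof.
wlog Vyx : x y / x != 0 /\ V (y / x).
  move=> W nx ny.
  have [->|x0] := eqVneq x 0; first by rewrite add0r.
  have [->|y0] := eqVneq y 0; first by rewrite addr0.
  have [V1|] := hV.2 (y / x) (mulf_neq0 y0 (invr_neq0 x0)); first exact: W.
  by rewrite invf_div addrC => V1; apply: W.
case: Vyx => x0 Vyx [/eqP|nx _]; first by rewrite (negPf x0).
have [|xy0] := eqVneq (x + y) 0; [by left|right=> Vxy; apply: nx].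
have -> : x^-1 = (x + y)^-1 * (1 + y / x) by field; apply/andP.
by apply: subringM => //; apply: subringD => //; apply: subring1.
Qed.

(** In a vanishing sum two nonzero terms have the same value: otherwise divide
    by the unique term of least value, so that [-1] becomes a sum of elements
    of the maximal ideal. *)
Lemma vanishing_sum_unit_ratio (I : finType) (z : I -> F) (i0 : I) :
  z i0 != 0 -> \sum_i z i = 0 ->
  exists i j, [/\ i != j, z i != 0, z j != 0 & unit_in V (z i / z j)].
Proof.
move=> zi0 sum0; pose s := [seq i <- enum I | z i != 0].
have ins i : (i \in s) = (z i != 0) by rewrite mem_filter mem_enum andbT.
have [|| i] := @valuation_ring_minimal _ z s.
- by move=> i; rewrite ins.
- by apply/eqP => s0; move: (ins i0); rewrite s0 zi0.
rewrite ins => zi min_i; apply: contrapT => no.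
have [|] : nonunit (\sum_(j | j != i) z j / z i); last 1 first.
- suff -> : \sum_(j | j != i) z j / z i = -1.
    by rewrite invrN invr1 => /(_ (subringN sV (subring1 sV))).
  rewrite -mulr_suml; apply: (mulIf zi); rewrite divfK // mulN1r.
  by move: sum0; rewrite (bigD1 i) //= addrC => /eqP; rewrite addr_eq0 => /eqP.
- elim/big_ind: _; [by left | exact: nonunitD | move=> j ji].
  have [->|zj] := eqVneq (z j) 0; first by left; rewrite mul0r.
  right=> Vij; apply: no; exists j, i; split=> //; split=> //.
  by apply: min_i; rewrite ins.
move=> sum1; have : \sum_j z j / z i = 1.
  by rewrite (bigD1 i) //= divff // sum1 addr0.
by rewrite -mulr_suml sum0 mul0r => /esym/eqP; rewrite oner_eq0.
Qed.

End ValuationRingFacts.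

(** * Extensions of a discrete valuation *)

Section DiscreteValuation.

Variables (K : fieldType) (v : K -> \bar int).
Hypothesis hv : is_normalized_discrete_valuation v.
Variable pi : K.
Hypothesis hpi : is_uniformizer v pi.

Lemma val_uniformizer : v pi = 1%:E.
Proof.
have [hval surj] := hv; have [_ gen] := hpi.
have [x vx] := surj 1.
have [|a va xE] := (gen x).1 _; first by rewrite inE vx lte_fin.
have : (0 < v pi)%E.
  have : pi \in valideal v.
    by apply/gen; exists 1; rewrite ?mulr1 // inE (valuation1 hval) lee_fin.
  by rewrite inE.
have : pi != 0.
  by apply/eqP => p0; rewrite xE p0 mul0r (valuation0 hval) in vx.
case/(valuation_fin hval) => k vp; rewrite vp lte_fin => k0.
have : a != 0.
  by apply/eqP => a0; rewrite xE a0 mulr0 (valuation0 hval) in vx.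
case/(valuation_fin hval) => l vl; move: va; rewrite inE vl lee_fin => l0.
move: vx; rewrite xE valuationM // vp vl -EFinD => -[E].
by congr EFin; lia.
Qed.

Lemma uniformizer_neq0 : pi != 0.
Proof.
apply/eqP => p0; have := val_uniformizer; by rewrite p0 (valuation0 hv.1).
Qed.

Lemma valXz_uniformizer (k : int) : v (pi ^ k) = k%:E.
Proof. by rewrite (valuationXz hv.1 _ val_uniformizer) intz. Qed.

Lemma eqmod_powP d x y : eqmod_pow v pi d x y <-> (d%:Z%:E <= v (x - y))%E.
Proof.
have p0 := uniformizer_neq0; have hval := hv.1; split.
  case=> a; rewrite inE => va ->; rewrite valuationM // exprnP valXz_uniformizer.
  by rewrite -[leLHS]adde0 leeD2lE.
move=> le; exists (pi ^- d * (x - y)); last by rewrite mulVKf // expf_neq0.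
rewrite inE valuationM // exprnN valXz_uniformizer.
by case: (v _) le => [k||] //; rewrite -?EFinD ?lee_fin //; lia.
Qed.

Variable L : fieldExtType K.

(** A common denominator for the values of all extensions: by [power_value] some
    positive power of [y] with exponent at most the degree has the value of an
    element of [K], and the exponent divides this factorial. *)
Definition value_denominator : nat := (\dim {:L})`!.
Local Notation N := value_denominator.

Section ValueGroup.

Variable V : set L.
Hypothesis hV : valuation_ring V.
Hypothesis VA : forall a, V (in_alg L a) <-> (0 <= v a)%E.

Lemma unit_in_base a : v a = 0%:E -> unit_in V (in_alg L a).
Proof.
by move=> va; rewrite /unit_in -fmorphV !VA (valuationV hv.1 va) va oppr0.
Qed.

(** The powers of [y] up to the degree are linearly dependent over [K], and two
    terms of such a relation have the same value. *)
Lemma power_value (y : L) : y != 0 ->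
  exists m, (0 < m <= \dim {:L})%N /\
    exists k : int, unit_in V (y ^+ m * in_alg L (pi ^ (- k))).
Proof.
move=> y0; have hval := hv.1; have p0 := uniformizer_neq0.
have /polyOver1P[q qE] := minPolyOver 1%AS y.
have sq : size q = (adjoin_degree 1%AS y).+1.
  by rewrite -(size_map_poly (in_alg L)) -qE size_minPoly.
have le_deg : (adjoin_degree 1%AS y <= \dim {:L})%N.
  have := dim_Fadjoin 1%AS y; rewrite dimv1 muln1 => <-.
  by apply: dimvS; apply: subvf.
pose z (i : 'I_(size q)) := in_alg L q`_i * y ^+ i.
have sum0 : \sum_i z i = 0.
  have /rootP := root_minPoly 1%AS y; rewrite qE horner_coef size_map_poly => E.
  by rewrite -[RHS]E; apply: eq_bigr => i _; rewrite coef_map.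
have top : ((size q).-1 < size q)%N by rewrite sq.
have z0 i : (z i != 0) = (q`_i != 0).
  by rewrite /z mulf_eq0 negb_or expf_neq0 // andbT fmorph_eq0.
have [|i [j [ij]]] := @vanishing_sum_unit_ratio _ _ hV _ z (Ordinal top) _ sum0.
  by rewrite z0 /= -lead_coefE lead_coef_eq0 -size_poly_eq0 sq.
wlog lt_ij : i j ij / (j < i)%N.
  move=> W zi zj U; case: (ltngtP i j) => [lt|lt|/ord_inj E].
  - apply: (W j i) => //; first by rewrite eq_sym.
    by rewrite -invf_div; apply: unit_inV.
  - exact: (W i j).
  - by rewrite E eqxx in ij.
rewrite !z0 => qi qj U; exists (i - j)%N; split.
  rewrite subn_gt0 lt_ij /=; apply: leq_trans le_deg; apply: leq_trans (leq_subr _ _) _.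
  by rewrite -ltnS -sq.
have [a va] := valuation_fin hval qi; have [b vb] := valuation_fin hval qj.
exists (b - a).
have -> : y ^+ (i - j) * in_alg L (pi ^ (- (b - a))) =
    z i / z j * in_alg L (q`_j / q`_i * pi ^ (a - b)).
  have -> : z i = in_alg L q`_i * (y ^+ (i - j) * y ^+ j).
    by rewrite -exprD subnK // ltnW.
  have Ei : in_alg L q`_i != 0 by rewrite fmorph_eq0.
  have Ej : in_alg L q`_j != 0 by rewrite fmorph_eq0.
  have Yj : y ^+ j != 0 by rewrite expf_neq0.
  rewrite opprB !rmorphM fmorphV /z; field.
  by apply/and3P.
apply: unit_inM => //; first exact: hV.1.
apply: unit_in_base; rewrite !valuationM // valXz_uniformizer vb (valuationV hval va) -!EFinD.
by congr EFin; lia.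
Qed.

Lemma value_exists (y : L) : y != 0 ->
  exists k : int, unit_in V (y ^+ N * in_alg L (pi ^ (- k))).
Proof.
move=> y0; have [m [/andP[m0 mN] [k U]]] := power_value y0.
have /dvdnP[c E] : (m %| N)%N by rewrite dvdn_fact // m0.
exists (k * c%:Z); have := unit_inX hV.1 c U.
have -> : pi ^ (- (k * c%:Z)) = (pi ^ (- k)) ^+ c by rewrite exprnP exprz_exp mulNr.
by rewrite rmorphXn -/N E mulnC exprM -exprMn.
Qed.

Definition value (y : L) : int :=
  xget 0 [set k | unit_in V (y ^+ N * in_alg L (pi ^ (- k)))]%classic.

Lemma valueP (y : L) : y != 0 -> unit_in V (y ^+ N * in_alg L (pi ^ (- value y))).
Proof. by move=> y0; apply: (xgetPex 0 (value_exists y0)). Qed.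

Lemma value_ge y k : y != 0 -> V (y ^+ N * in_alg L (pi ^ (- k))) <-> k <= value y.
Proof.
move=> y0; have U := valueP y0.
have -> : y ^+ N * in_alg L (pi ^ (- k)) =
    y ^+ N * in_alg L (pi ^ (- value y)) * in_alg L (pi ^ (value y - k)).
  by rewrite -mulrA -rmorphM -expfzDr ?uniformizer_neq0 // addKr.
split=> [Vk|le]; last first.
  apply: subringM; [exact: hV.1 | exact: U.1 | apply/VA].
  by rewrite valXz_uniformizer lee_fin subr_ge0.
rewrite -subr_ge0 -lee_fin -(valXz_uniformizer (value y - k)); apply/VA.
have := subringM hV.1 U.2 Vk; rewrite mulKf // mulf_neq0 //.
  by rewrite expf_neq0.
by rewrite fmorph_eq0 expfz_neq0 // uniformizer_neq0.
Qed.

Lemma value_uniq y k : y != 0 -> unit_in V (y ^+ N * in_alg L (pi ^ (- k))) ->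
  value y = k.
Proof.
move=> y0 [Uk Uk']; have [U U'] := valueP y0; apply/eqP; rewrite eq_le.
apply/andP; split; last exact/value_ge.
have yN : y ^+ N != 0 by rewrite expf_neq0.
have p0 l : in_alg L (pi ^ l) != 0.
  by rewrite fmorph_eq0 expfz_neq0 // uniformizer_neq0.
rewrite -subr_ge0 -lee_fin -(valXz_uniformizer (k - value y)); apply/VA.
have -> : in_alg L (pi ^ (k - value y)) =
    y ^+ N * in_alg L (pi ^ (- value y)) / (y ^+ N * in_alg L (pi ^ (- k))).
  have -> : pi ^ (- value y) = pi ^ (k - value y) * pi ^ (- k).
    by rewrite -expfzDr ?uniformizer_neq0 // addrAC subrr add0r.
  rewrite rmorphM mulrCA mulfK //; apply: mulf_neq0 => //; exact: p0.
by apply: subringM => //; exact: hV.1.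
Qed.

Lemma valueM x y : x != 0 -> y != 0 -> value (x * y) = value x + value y.
Proof.
move=> x0 y0; apply: value_uniq; first by rewrite mulf_neq0.
rewrite exprMn opprD expfzDr ?uniformizer_neq0 // rmorphM mulrACA.
by apply: unit_inM; [exact: hV.1 | exact: valueP | exact: valueP].
Qed.

Lemma value_ge0 y : y != 0 -> (0 <= value y) <-> V y.
Proof.
move=> y0; split=> [/(value_ge _ y0)|Vy]; last first.
  apply/value_ge => //; rewrite oppr0 expr0z rmorph1 mulr1.
  by apply: subringX; first exact: hV.1.
rewrite oppr0 expr0z rmorph1 mulr1 => VyN.
have [//|Vy'] := hV.2 _ y0.
have N0 : (0 < N)%N by apply: fact_gt0.
have -> : y = y ^+ N * y^-1 ^+ N.-1.
  by rewrite -[in y ^+ N](prednK N0) exprS exprVn mulfK // expf_neq0.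
by apply: subringM => //; [exact: hV.1 | apply: subringX => //; exact: hV.1].
Qed.

Lemma value_base a k : v a = k%:E -> value (in_alg L a) = k * N%:Z.
Proof.
move=> va; have a0 : a != 0.
  by apply/eqP => a0; rewrite a0 (valuation0 hv.1) in va.
apply: value_uniq; first by rewrite fmorph_eq0.
rewrite -rmorphXn -rmorphM; apply: unit_in_base.
rewrite (valuationM hv.1) valXz_uniformizer (valuationX hv.1 _ va) -EFinD.
by congr EFin; rewrite -mulr_natr; lia.
Qed.

Lemma value_minD x y : x != 0 -> y != 0 -> x + y != 0 ->
  value x <= value y -> value x <= value (x + y).
Proof.
move=> x0 y0 xy0 le_xy.
have z0 : 1 + y / x != 0.
  by apply: contraNneq xy0 => E; rewrite -[x + y](divfK x0) mulrDl divff // E mul0r.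
have -> : x + y = x * (1 + y / x) by field.
rewrite valueM // ler_wpDr //; apply/value_ge0 => //.
have yx0 : y / x != 0 by rewrite mulf_neq0 ?invr_eq0.
apply: subringD; [exact: hV.1 | apply: subring1; exact: hV.1 |].
apply/value_ge0 => //; rewrite -(lerD2l (value x)) addr0 -valueM //.
by rewrite mulrC divfK.
Qed.

(** By [value_exists], [y ^+ N] is [pi ^ k] up to a unit of [V], so that [y] has
    value [k / N]. *)
Definition ring_valuation (y : L) : \bar rat :=
  if y == 0 then +oo%E else ((value y)%:~R / N%:R)%:E.

Lemma ring_valuation_is_valuation : is_valuation ring_valuation.
Proof.
have N0 : 0 < N%:R :> rat by rewrite ltr0n fact_gt0.
rewrite /ring_valuation; split.
- by move=> x; case: ifP.
- by move=> x; case: eqP.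
- move=> x y; rewrite mulf_eq0.
  have [|x0] := eqVneq x 0; first by case: (y == 0).
  have [//|y0] := eqVneq y 0.
  by rewrite /= valueM // rmorphD mulrDl EFinD.
- move=> x y.
  have [->|x0] := eqVneq x 0; first by rewrite add0r ge_min lexx orbT.
  have [->|y0] := eqVneq y 0; first by rewrite addr0 (negPf x0) ge_min lexx.
  have [//|xy0] := eqVneq (x + y) 0; first by rewrite leey.
  rewrite ge_min !lee_fin !ler_pM2r ?invr_gt0 // !ler_int.
  have [le|/ltW le] := leP (value x) (value y).
    by rewrite value_minD.
  by rewrite addrC [X in _ || X]value_minD ?orbT // addrC.
Qed.

Lemma ring_valuation_extends : extends v ring_valuation.
Proof.
have N0 : N%:R != 0 :> rat by rewrite pnatr_eq0 -lt0n fact_gt0.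
move=> a; rewrite /ring_valuation fmorph_eq0.
have [->|a0] := eqVneq a 0; first by rewrite (valuation0 hv.1).
have [k va] := valuation_fin hv.1 a0.
by rewrite (value_base va) va /= rmorphM /= mulfK.
Qed.

Lemma ring_valuation_ge0 y : (0 <= ring_valuation y)%E <-> V y.
Proof.
have N0 : 0 < N%:R :> rat by rewrite ltr0n fact_gt0.
rewrite /ring_valuation; have [->|y0] := eqVneq y 0.
  by split=> _; [apply: subring0; exact: hV.1 | rewrite leey].
by rewrite lee_fin pmulr_lge0 ?invr_gt0 // ler0z; apply: value_ge0.
Qed.

End ValueGroup.

Lemma extends_ring (u : L -> \bar rat) a :
  extends v u -> [set x | 0 <= u x]%classic%E (in_alg L a) <-> (0 <= v a)%E.
Proof.
move=> /(_ a) /= ->; case: (v a) => [k| |] //=; by rewrite !lee_fin ler0z.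
Qed.

(** The valuation ring of [u] meets [K] in [A], so the analysis above applies to
    it. *)
Lemma extension_value_denom (u : L -> \bar rat) (y : L) :
  is_valuation u -> extends v u -> y != 0 ->
  exists k : int, u y = (k%:~R / N%:R)%:E.
Proof.
move=> hu eu y0.
have hV := val_ring_valuation_ring hu.
have [k U] := value_exists hV (fun a => extends_ring a eu) y0.
have [c uy] := valuation_fin hu y0; exists k; rewrite uy.
have N0 : N%:R != 0 :> rat by rewrite pnatr_eq0 -lt0n fact_gt0.
case: U => /=.
have E : u (y ^+ N * in_alg L (pi ^ (- k))) = (c *+ N - k%:~R)%:E.
  by rewrite valuationM // (valuationX hu _ uy) eu valXz_uniformizer /= -EFinD rmorphN.
rewrite (valuationV hu E) E !lee_fin => l1 l2; congr EFin.
by apply: (mulIf N0); rewrite divfK // mulr_natr; lra.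
Qed.

(** A valuation ring that meets [K] in more than [A] contains [pi^-1], hence all
    of [K], hence the polynomials over [K] in [x^-1]; since [x^-1] is algebraic,
    [x] is one of these. *)
Lemma valuation_ring_meets_base (V : set L) (x : L) :
  valuation_ring V -> (forall a, 0 <= v a -> V (in_alg L a))%E ->
  V x^-1 -> ~ V x ->
  forall a, V (in_alg L a) <-> (0 <= v a)%E.
Proof.
move=> hV VA Vx' nVx a; split; last exact: VA.
move=> Va; rewrite leNgt; apply/negP => va.
have sV := hV.1; have hval := hv.1.
have Vpi : V (in_alg L pi^-1).
  case E: (v a) va => [k||] //; last by case: hval => /(_ a).
  rewrite lte_fin => k0.
  have a0 : a != 0 by apply/eqP => a0; rewrite a0 (valuation0 hval) in E.
  have -> : pi^-1 = a * (a^-1 * pi^-1) by rewrite mulVKf.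
  rewrite rmorphM; apply: subringM => //; apply: VA.
  rewrite valuationM // (valuationV hval E) (valuationV hval val_uniformizer).
  by rewrite -EFinD lee_fin; lia.
have VK b : V (in_alg L b).
  have [->|b0] := eqVneq b 0; first by rewrite rmorph0; apply: subring0.
  have [k E] := valuation_fin hval b0.
  case: (leP 0 k) => k0; first by apply: VA; rewrite E lee_fin.
  have -> : b = b * pi ^+ `|k|%N * (pi^-1) ^+ `|k|%N.
    by rewrite exprVn mulfK // expf_neq0 // uniformizer_neq0.
  rewrite rmorphM rmorphXn; apply: subringM => //; last exact: subringX.
  apply: VA; rewrite valuationM // (valuationX hval _ val_uniformizer) E -EFinD.
  by rewrite lee_fin; lia.
apply: nVx.
have : x \in <<1; x^-1>>%VS by rewrite -[X in X \in _]invrK memvV memv_adjoin.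
case/Fadjoin_polyP => p /polyOver1P[q ->] ->.
rewrite horner_coef; apply: subring_sum => // i _; apply: subringM => //.
  by rewrite coef_map; apply: VK.
exact: subringX.
Qed.

Lemma exists_negative_extension (S : set L) (x : L) :
  subring S -> (forall a, 0 <= v a -> S (in_alg L a))%E ->
  S x^-1 -> ~ S x ->
  exists u : L -> \bar rat, [/\ is_valuation u, extends v u & (u x < 0)%E].
Proof.
move=> hS SA Sx' nSx; have [V [hV SV nVx]] := exists_valuation_ring hS Sx' nSx.
have VA : forall a, V (in_alg L a) <-> (0 <= v a)%E.
  apply: valuation_ring_meets_base (SV _ Sx') nVx => // a /SA; exact: SV.
exists (ring_valuation V); split.
- exact: ring_valuation_is_valuation.
- exact: ring_valuation_extends.
- by rewrite ltNge; apply/negP => /(ring_valuation_ge0 hV VA).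
Qed.

(** If [x] is not in [V] then [x^-1] is; dividing a monic equation of degree
    [d + 1] by [x ^+ d] then expresses [x] as a polynomial in [x^-1]. *)
Lemma integral_in_valuation_ring (V : set L) (x : L) :
  valuation_ring V -> (forall a, 0 <= v a -> V (in_alg L a))%E ->
  integral_closure v x -> V x.
Proof.
move=> hV VA [p [p_mon /allP p_int /rootP px]]; have sV := hV.1.
have Vp i : V (in_alg L p`_i).
  have [lt|ge] := ltnP i (size p); first by apply: VA; apply/p_int/mem_nth.
  by rewrite nth_default // rmorph0; apply: subring0.
have [->|x0] := eqVneq x 0; first exact: subring0.
have [//|Vx'] := hV.2 x x0.
have [d sp] : exists d, size p = d.+1.
  by exists (size p).-1; rewrite prednK // lt0n size_poly_eq0 monic_neq0.
move: px; rewrite horner_coef size_map_poly sp big_ord_recr /= !coef_map /=.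
have -> : p`_d = 1 by move/monicP: p_mon; rewrite lead_coefE sp.
rewrite scale1r mul1r => /eqP; rewrite addrC addr_eq0 => /eqP E.
case: d sp E => [|d] sp E.
  by move: E; rewrite big_ord0 oppr0 => /eqP; rewrite expr0 oner_eq0.
have -> : x = x ^+ d.+1 * x^-1 ^+ d by rewrite exprS exprVn mulfK // expf_neq0.
rewrite E mulNr; apply: subringN => //; rewrite mulr_suml.
apply: subring_sum => // i _; rewrite coef_map -mulrA.
apply: subringM => //; first exact: Vp.
have le : (i <= d)%N by rewrite -ltnS.
have -> : x^-1 ^+ d = x^-1 ^+ i * x^-1 ^+ (d - i) by rewrite -exprD subnKC.
by rewrite mulrA exprVn mulfV ?expf_neq0 // mul1r; apply: subringX.
Qed.

(** The ring [A], seen inside [L]. *)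
Definition base_ring : set L :=
  [set x | exists2 a, (0 <= v a)%E & x = in_alg L a]%classic.

Lemma base_ring_subring : subring base_ring.
Proof.
have [[A1 AB AM] _] := val_ring_valuation_ring hv.1; split.
- by exists 1; rewrite ?rmorph1.
- move=> _ _ [a va ->] [b vb ->]; exists (a - b); last by rewrite rmorphB.
  exact: AB.
- move=> _ _ [a va ->] [b vb ->]; exists (a * b); last by rewrite rmorphM.
  exact: AM.
Qed.

Lemma in_alg_base_ring a : base_ring (in_alg L a) <-> (0 <= v a)%E.
Proof. by split=> [[b vb /fmorph_inj ->]|va] //; exists a. Qed.

(** Multiplying [x = p (1/x)] by a power of [x] gives a monic equation over
    [A]. *)
Lemma adjoin_inverse_integral (x : L) :
  x != 0 -> adjoin base_ring x^-1 x -> integral_closure v x.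
Proof.
move=> x0 [p hp xE].
have /choice[c cP] i : exists a, (0 <= v a)%E /\ p`_i = in_alg L a.
  by have [a va E] := hp i; exists a.
pose d := size p; pose r : {poly K} := \poly_(i < d) c (d - i.+1)%N.
have sr : (size r <= d)%N by apply: size_poly.
exists ('X^d - r); split.
- by rewrite monicE lead_coefDl ?lead_coefXn // size_polyXn size_polyN ltnS.
- apply/allP => _ /(nthP 0)[i _ <-]; rewrite coefB coefXn coef_poly inE.
  apply: (subringB (val_ring_valuation_ring hv.1).1).
    by rewrite /= ; case: eqP; rewrite ?(valuation1 hv.1) ?(valuation0 hv.1).
  by case: ifP => _; [case: (cP (d - i.+1)%N) | rewrite /= (valuation0 hv.1)].
apply/rootP; rewrite rmorphB /= map_polyXn hornerD hornerN hornerXn.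
rewrite (@horner_coef_wide _ d) ?size_map_poly //.
rewrite (reindex_inj rev_ord_inj) /=.
have [d' dE] : exists d', d = d'.+1.
  exists d.-1; rewrite prednK // lt0n size_poly_eq0.
  by apply: contra_neq x0 => p0; rewrite xE p0 horner0.
apply/eqP; rewrite subr_eq0; apply/eqP.
transitivity (x ^+ d' * x); first by rewrite dE exprSr.
rewrite [X in _ * X]xE horner_coef mulr_sumr -/d; apply: eq_bigr => i _.
have lt := ltn_ord i; rewrite coef_map coef_poly /= (cP i).2.
have -> : (d - i.+1 < d)%N by lia.
have -> : (d - (d - i.+1).+1 = i)%N by lia.
rewrite mulrCA; congr (_ * _).
have le : (i <= d')%N by lia.
have -> : (d - i.+1 = d' - i)%N by lia.
have -> : x ^+ d' = x ^+ (d' - i) * x ^+ i by rewrite -exprD subnK.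
by rewrite exprVn mulfK // expf_neq0.
Qed.

(** The integral closure is cut out by the extensions of [v]; for [x] not
    integral, extend [v] through a valuation ring containing [A[1/x]]. *)
Lemma integral_closureP (x : L) :
  integral_closure v x <->
  (forall u : L -> \bar rat, is_valuation u -> extends v u -> 0 <= u x)%E.
Proof.
split=> [xi u hu eu|h].
  apply: (integral_in_valuation_ring (val_ring_valuation_ring hu)) xi => a va.
  exact/extends_ring.
apply: contrapT => nx.
have [x0|x0] := eqVneq x 0.
  apply: nx; rewrite x0; exists 'X; split; first exact: monicX.
    apply/allP => _ /(nthP 0)[i _ <-]; rewrite coefX inE.
    have [hA _] := val_ring_valuation_ring hv.1.
    by case: eqP => _; [exact: (subring1 hA) | exact: (subring0 hA)].
  by rewrite map_polyX rootX.
have sB := base_ring_subring.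
have [||||u [hu eu]] := @exists_negative_extension (adjoin base_ring x^-1) x.
- exact: adjoin_subring.
- by move=> a /in_alg_base_ring ba; apply: sub_adjoin.
- exact: mem_adjoin.
- by move=> /(adjoin_inverse_integral x0).
- by rewrite ltNge h.
Qed.

(** Without this, the minimum below would be that of an empty family. It
    follows as above, with [pi^-1] as the element to be excluded. *)
Lemma exists_extension : exists u : L -> \bar rat, is_valuation u /\ extends v u.
Proof.
have vp := valuationV hv.1 val_uniformizer.
have [||||u [hu eu _]] := @exists_negative_extension base_ring (in_alg L pi^-1).
- exact: base_ring_subring.
- by move=> a /in_alg_base_ring.
- by rewrite -fmorphV invrK; apply/in_alg_base_ring; rewrite val_uniformizer.
- by move/in_alg_base_ring; rewrite vp.
- by exists u.
Qed.

End DiscreteValuation.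

(** * The minimum of the extensions *)

Section UltrametricSums.

Variables (G : realDomainType) (M : nmodType) (f : M -> \bar G).
Hypothesis f0 : f 0 = +oo%E.
Hypothesis fD : forall x y, (Order.min (f x) (f y) <= f (x + y)%R)%E.

Lemma ultra_sum_ge (I : Type) (r : seq I) (P : pred I) (z : I -> M) c :
  (forall i, P i -> c <= f (z i))%E -> (c <= f (\sum_(i <- r | P i) z i)%R)%E.
Proof.
move=> h; elim/big_ind : _ => // [|x y cx cy]; first by rewrite f0 leey.
by apply: le_trans (fD _ _); rewrite le_min cx.
Qed.

Lemma ultra_sum_gt (I : Type) (r : seq I) (P : pred I) (z : I -> M) c :
  c != +oo%E ->
  (forall i, P i -> c < f (z i))%E -> (c < f (\sum_(i <- r | P i) z i)%R)%E.
Proof.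
move=> c0 h; elim/big_ind : _ => // [|x y cx cy]; first by rewrite f0 ltey.
by apply: lt_le_trans (fD _ _); rewrite lt_min cx.
Qed.

End UltrametricSums.

(** What the argument uses about the minimum [w] of the valuations extending
    [v]: it is the gauge of the integral closure, with denominators dividing
    [e]. *)
Record integral_gauge (K : fieldType) (L : fieldExtType K) (v : K -> \bar int)
    (e : nat) (w : L -> \bar rat) : Prop := IntegralGauge {
  gauge_eqy : forall x, w x = +oo%E <-> x = 0;
  gauge_minD : forall x y, (Order.min (w x) (w y) <= w (x + y)%R)%E;
  gaugeZ : forall a x, w (a *: x) = (er_map intr (v a) + w x)%E;
  gaugeM : forall x y, (w x + w y <= w (x * y)%R)%E;
  gauge_integral : forall x, integral_closure v x <-> (0 <= w x)%E;
  gauge_denom : forall x, x != 0 -> exists k : int, w x = (k%:~R / e%:R)%:E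
}.

Section MinimumOfExtensions.

Variables (K : fieldType) (v : K -> \bar int).
Hypothesis hv : is_normalized_discrete_valuation v.
Variable pi : K.
Hypothesis hpi : is_uniformizer v pi.
Variables (L : fieldExtType K) (t : nat) (ws : 'I_t -> L -> \bar rat).
Hypothesis hws : lists_extensions v ws.

Let wsP i : is_valuation (ws i) /\ extends v (ws i).
Proof. by apply/hws; exists i. Qed.

Lemma minval_integral_gauge :
  integral_gauge v (value_denominator L) (minval ws).
Proof.
have [u0 /hws[i0 _]] := exists_extension hv hpi L.
have attained x : exists i, minval ws x = ws i x.
  rewrite /minval; have [|i _ ->] := @eq_bigmin _ _ _ +oo%E i0 predT (ws^~ x) isT.
    by move=> i _; rewrite leey.
  by exists i.
have le_min x i : (minval ws x <= ws i x)%E by apply: bigmin_le.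
split.
- move=> x; split=> [E|->].
    have [[_ eqy _ _] _] := wsP i0; apply/eqy/eqP.
    by rewrite -leye_eq -E.
  by have [i ->] := attained 0; apply: valuation0 (wsP i).1.
- move=> x y; have [i ->] := attained (x + y).
  apply: le_trans (valuation_minD (wsP i).1 _ _).
  by rewrite le_min2 ?le_min.
- move=> a x.
  have wE i : ws i (a *: x) = (er_map intr (v a) + ws i x)%E.
    have [hi ei] := wsP i; rewrite -(ei a) -valuationM //; congr ws.
    by rewrite /= -scalerAl mul1r.
  apply/eqP; rewrite eq_le; apply/andP; split.
    by have [i ->] := attained x; rewrite -wE.
  by have [i ->] := attained (a *: x); rewrite wE; apply: leeD2l.
- move=> x y; have [i ->] := attained (x * y); rewrite (valuationM (wsP i).1).
  exact: leeD.
- move=> x; split=> [/(integral_closureP hv hpi) h|w0].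
    by have [i ->] := attained x; have [] := wsP i; apply: h.
  apply/(integral_closureP hv hpi) => u hu eu.
  have /hws[i <-] : is_valuation u /\ extends v u by [].
  exact: le_trans w0 (le_min _ _).
- move=> x x0; have [i ->] := attained x; have [hi ei] := wsP i.
  exact: (extension_value_denom hv hpi hi ei x0).
Qed.

End MinimumOfExtensions.

(** * Monic polynomials of maximal value *)

Section Triangular.

Variables (K : fieldType) (v : K -> \bar int).
Hypothesis hv : is_normalized_discrete_valuation v.
Variable pi : K.
Hypothesis hpi : is_uniformizer v pi.
Variables (L : fieldExtType K) (w : L -> \bar rat) (e : nat).
Hypotheses (e_gt0 : (0 < e)%N) (hw : integral_gauge v e w).
Variables (theta : L) (n : nat).
Hypothesis n_gt0 : (0 < n)%N.
Hypothesis theta_int : integral_closure v theta.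
Hypothesis theta_deg : adjoin_degree 1%AS theta = n.
Hypothesis theta_gen : <<1; theta>>%VS = {:L}%VS.
Hypothesis B_fg : fg_over_valring v (integral_closure (L := L) v).

Let hval : is_valuation v := hv.1.
Let vA : subring [set x | 0 <= v x]%classic%E := (val_ring_valuation_ring hval).1.

Local Notation ev := (evalL theta).
Local Notation mono := (monic_over_valring v).
Local Notation dl := (delta v w theta).

Lemma polyOver_valringP (p : {poly K}) :
  p \is a polyOver (valring v) <-> forall i, (0 <= v p`_i)%E.
Proof.
split=> [/allP h i|h]; last first.
  by apply/allP => _ /(nthP 0)[i _ <-]; exact: h.
have [lt|ge] := ltnP i (size p); first by apply/h/mem_nth.
by rewrite nth_default // (valuation0 hval) leey.
Qed.

Lemma evalL_sum (I : Type) (r : seq I) (P : pred I) (a : I -> K)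
    (g : I -> {poly K}) :
  ev (\sum_(i <- r | P i) a i *: g i) = \sum_(i <- r | P i) a i *: ev (g i).
Proof.
rewrite /evalL rmorph_sum /= horner_sum; apply: eq_bigr => i _.
by rewrite map_polyZ hornerZ /= mulr_algl.
Qed.

Lemma evalLZ a g : ev (a *: g) = a *: ev g.
Proof. by rewrite /evalL map_polyZ hornerZ /= mulr_algl. Qed.

Lemma evalLD g h : ev (g + h) = ev g + ev h.
Proof. by rewrite /evalL rmorphD hornerD. Qed.

Lemma evalLB g h : ev (g - h) = ev g - ev h.
Proof. by rewrite /evalL rmorphB /= hornerD hornerN. Qed.

Lemma evalL_surj x : exists2 p : {poly K}, (size p <= n)%N & ev p = x.
Proof.
have /polyOver1P[p pE] := Fadjoin_polyOver 1%AS theta x.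
exists p.
  by rewrite -(size_map_poly (in_alg L)) -pE -theta_deg size_Fadjoin_poly.
by rewrite /evalL -pE Fadjoin_poly_eq // theta_gen memvf.
Qed.

Lemma evalL_eq0 (p : {poly K}) : (size p <= n)%N -> ev p = 0 -> p = 0.
Proof.
move=> sp /rootP; rewrite (@root_small_adjoin_poly _ _ 1%AS) ?alg_polyOver //.
  by rewrite map_poly_eq0 => /eqP.
by rewrite size_map_poly theta_deg.
Qed.

Lemma evalL_inj (p q : {poly K}) : (size p <= n)%N -> (size q <= n)%N -> ev p = ev q -> p = q.
Proof.
move=> sp sq E; apply/eqP; rewrite -subr_eq0; apply/eqP/evalL_eq0.
  by rewrite (leq_trans (size_polyD _ _)) // size_polyN geq_max sp.
by rewrite evalLB E subrr.
Qed.

Lemma gauge0 : w 0 = +oo%E.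
Proof. by apply/(gauge_eqy hw). Qed.

Lemma gauge_fin x : x != 0 -> exists r, w x = r%:E.
Proof. by case/(gauge_denom hw) => k ->; eexists. Qed.

Lemma gaugeZ_fin a k x : v a = k%:E -> w (a *: x) = (k%:~R%:E + w x)%E.
Proof. by move=> E; rewrite (gaugeZ hw) E. Qed.

Lemma gaugeN x : w (- x) = w x.
Proof.
by rewrite -scaleN1r (gaugeZ hw) (valuationN hval) (valuation1 hval) /= add0e.
Qed.

Lemma mono_neq0 j g : mono j g -> g != 0.
Proof. by case=> /monic_neq0. Qed.

Lemma ev_mono_neq0 j g : (j < n)%N -> mono j g -> ev g != 0.
Proof.
move=> jn mg; apply: contraNneq (mono_neq0 mg) => /evalL_eq0 -> //.
by case: mg => _ _ ->.
Qed.

(** The value [fine +oo] is [0], so vanishing entries do not affect the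
    bound. *)
Lemma common_denominator (I : finType) (z : I -> K) :
  exists m : nat, forall i, ((- m%:Z)%:E <= v (z i))%E.
Proof.
exists (\max_i `|fine (v (z i))|%N) => i.
have := @leq_bigmax _ (fun i => `|fine (v (z i))|%N) i.
case: hval => /(_ (z i)) + _ _ _.
by case: (v (z i)) => [k||] //= _ le; rewrite ?leey // lee_fin; lia.
Qed.

(** [B] lies in [pi ^- m A[theta]] for some [m], and the coefficient of degree
    [j] of [pi ^- k g] is [pi ^- k]. *)
Lemma gauge_bounded : exists m : nat,
  forall j g, (j < n)%N -> mono j g -> (w (ev g) <= m%:R%:E)%E.
Proof.
have [s [_ s_gen]] := B_fg.
have /choice[q qP] (i : 'I_(size s)) :
    exists p : {poly K}, (size p <= n)%N /\ ev p = s`_i.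
  by have [p] := evalL_surj s`_i; exists p.
have [m mP] := common_denominator (fun ij : 'I_(size s) * 'I_n => (q ij.1)`_ij.2).
exists m.+1 => j g jn mg; have [r rE] := gauge_fin (ev_mono_neq0 jn mg).
pose k := Num.floor r.
have vk : v (pi ^ (- k)) = (- k)%:E by rewrite valXz_uniformizer.
have [|a [aA E]] := s_gen (pi ^ (- k) *: ev g).
  apply/(gauge_integral hw); rewrite (gaugeZ_fin _ vk) rE -EFinD lee_fin.
  by rewrite rmorphN addrC subr_ge0 floor_le.
have gE : pi ^ (- k) *: g = \sum_i a i *: q i.
  apply: evalL_inj.
  - apply: leq_trans (size_scale_leq _ _) _; by case: mg => _ _ ->.
  - apply: (big_ind (fun p : {poly K} => size p <= n)%N).
    + by rewrite size_poly0.
    + by move=> x y sx sy; rewrite (leq_trans (size_polyD _ _)) // geq_max sx.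
    + by move=> i _; apply: leq_trans (size_scale_leq _ _) (qP i).1.
  - by rewrite evalLZ evalL_sum E; apply: eq_bigr => i _; rewrite (qP i).2.
have : ((- m%:Z)%:E <= v (pi ^ (- k)))%E.
  have -> : pi ^ (- k) = \sum_i a i * (q i)`_j.
    have := congr1 (fun p : {poly K} => p`_j) gE; rewrite /= coefZ coef_sum.
    have -> : g`_j = 1 by case: mg => /monicP + _ sg; rewrite lead_coefE sg.
    by rewrite mulr1 => ->; apply: eq_bigr => i _; rewrite coefZ.
  apply: (ultra_sum_ge (valuation0 hval) (valuation_minD hval)) => i _.
  have := mP (i, Ordinal jn); rewrite /= valuationM // => le.
  by rewrite -[leLHS]add0e; apply: (leeD _ le); have := aA i; rewrite inE.
rewrite vk lee_fin lerN2 -/k rE lee_fin => km.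
have := floorD1_gt r; rewrite -/k => /ltW /le_trans; apply.
by rewrite -[m.+1%:R]/(m.+1%:Z%:~R) ler_int; lia.
Qed.

(** The values in question are of the form [k / e] with [k <= m * e]; the
    maximum is found by minimizing the natural number [m * e - k]. *)
Lemma max_value_exists j : (j < n)%N -> exists d, is_max_value v w theta j d.
Proof.
move=> jn; have [m mP] := gauge_bounded.
have eR : 0 < e%:R :> rat by rewrite ltr0n.
have val_k g : mono j g -> exists2 k : int, k <= (m * e)%N%:Z &
    w (ev g) = (k%:~R / e%:R)%:E.
  move=> mg; have [k E] := gauge_denom hw (ev_mono_neq0 jn mg).
  exists k => //; have := mP _ _ jn mg; rewrite E lee_fin ler_pdivrMr //.
  by rewrite -natrM -[(m * e)%:R]/((m * e)%N%:Z%:~R) ler_int.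
pose P i := `[< exists2 g, mono j g &
  w (ev g) = (((m * e)%N%:Z - i%:Z)%:~R / e%:R)%:E >].
have exP : exists i, P i.
  have mX : mono j 'X^j.
    split; rewrite ?monicXn ?size_polyXn //; apply/polyOver_valringP => i.
    by rewrite coefXn; case: eqP => _; [exact: (subring1 vA)|exact: (subring0 vA)].
  have [k km E] := val_k _ mX; exists `|(m * e)%N%:Z - k|%N.
  by apply/asboolP; exists 'X^j => //; rewrite E; congr (_%:~R / _)%:E; lia.
case: (ex_minnP exP) => i /asboolP[g mg gE] i_min.
exists (((m * e)%N%:Z - i%:Z)%:~R / e%:R); split; first by exists g.
move=> h mh; have [k km E] := val_k _ mh.
have /i_min : P `|(m * e)%N%:Z - k|%N.
  by apply/asboolP; exists h => //; rewrite E; congr (_%:~R / _)%:E; lia.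
rewrite E lee_fin ler_pM2r ?invr_gt0 // ler_int; lia.
Qed.

Lemma deltaP j : (j < n)%N -> is_max_value v w theta j (dl j).
Proof. by move=> jn; apply: xgetPex (max_value_exists jn). Qed.

Lemma delta_ge j g : (j < n)%N -> mono j g -> (w (ev g) <= (dl j)%:E)%E.
Proof. by move/deltaP => [_ +]; apply. Qed.

(** Multiply a maximal polynomial by ['X]: as [theta] is integral, this does not
    lower its value. *)
Lemma delta_mono i j : (i <= j)%N -> (j < n)%N -> dl i <= dl j.
Proof.
elim: j => [|j IH]; first by rewrite leqn0 => /eqP ->.
rewrite leq_eqVlt => /orP[/eqP -> //|]; rewrite ltnS => ij jn.
apply: le_trans (IH ij (ltnW jn)) _.
have [[g [g_mon g_int g_size] gE] _] := deltaP (ltnW jn).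
have mX : mono j.+1 (g * 'X).
  split; rewrite ?monicMr ?monicX //; last by rewrite size_mulX ?monic_neq0 ?g_size.
  apply/polyOver_valringP => k; rewrite coefMX; case: eqP => _.
    exact: (subring0 vA).
  by move/polyOver_valringP: g_int.
have := delta_ge jn mX; rewrite -lee_fin -gE; apply: le_trans.
have -> : ev (g * 'X) = ev g * theta by rewrite /evalL rmorphM /= map_polyX hornerMX.
apply: le_trans (gaugeM hw _ _); rewrite -[leLHS]adde0; apply: leeD => //.
exact/(gauge_integral hw).
Qed.

(** * Reducedness and the integral basis *)

Section MaximalFamily.

Variable g : 'I_n -> {poly K}.
Hypothesis g_mono : forall j : 'I_n, mono j (g j).
Hypothesis g_max : forall j : 'I_n, w (ev (g j)) = (dl j)%:E.

Lemma coef_g_lead (j : 'I_n) : (g j)`_j = 1.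
Proof. by case: (g_mono j) => /monicP + _ sg; rewrite lead_coefE sg. Qed.

Lemma coef_g_gt (j : 'I_n) i : (j < i)%N -> (g j)`_i = 0.
Proof. by move=> ji; rewrite nth_default //; case: (g_mono j) => _ _ ->. Qed.

Lemma ev_g_neq0 (j : 'I_n) : ev (g j) != 0.
Proof. exact: ev_mono_neq0 (g_mono j). Qed.

Lemma expansion (p : {poly K}) m : (m <= n)%N -> (size p <= m)%N ->
  exists2 a : 'I_n -> K, p = \sum_k a k *: g k &
    forall k : 'I_n, (m <= k)%N -> a k = 0.
Proof.
elim: m p => [|m IH] p mn sp.
  exists (fun=> 0) => //; rewrite big1 => [|k _]; last by rewrite scale0r.
  by apply/eqP; rewrite -size_poly_eq0 -leqn0.
pose o := Ordinal mn; pose q := p - p`_m *: g o.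
have [|a qE a0] := IH q (ltnW mn).
  apply/leq_sizeP => k; rewrite leq_eqVlt => /orP[/eqP <-|mk].
    by rewrite coefB coefZ (coef_g_lead o) mulr1 subrr.
  by rewrite coefB coefZ coef_g_gt // mulr0 subr0 nth_default // (leq_trans sp).
exists (fun k => a k + (if k == o then p`_m else 0)).
  under eq_bigr do rewrite scalerDl; rewrite big_split /= -qE.
  rewrite (bigD1 o) //= eqxx big1 ?addr0 => [|k /negPf ->]; last by rewrite scale0r.
  by rewrite subrK.
move=> k mk; rewrite a0 ?(ltnW mk) // add0r; case: eqP => // E.
by move: mk; rewrite E /= ltnn.
Qed.

Lemma expansion_top (a : 'I_n -> K) (o : 'I_n) :
  (forall k : 'I_n, (o < k)%N -> a k = 0) -> (\sum_k a k *: g k)`_o = a o.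
Proof.
move=> a0; rewrite coef_sum (bigD1 o) //= coefZ coef_g_lead mulr1.
rewrite big1 ?addr0 // => k ko; rewrite coefZ.
case: (ltngtP k o) => [lt|/a0 ->|/ord_inj E]; last by rewrite E eqxx in ko.
  by rewrite coef_g_gt // mulr0.
by rewrite mul0r.
Qed.

Lemma last_argmin (W : 'I_n -> \bar rat) : exists j : 'I_n,
  (forall i, W j <= W i)%E /\ (forall i : 'I_n, (j < i)%N -> W j < W i)%E.
Proof.
pose o := Ordinal n_gt0.
case: (@arg_minP _ _ _ o predT W isT) => i0 _ i0_min.
case: (@arg_maxnP _ i0 (fun i => W i == W i0) (fun i => val i) (eqxx _)) => j /eqP Wj jmax.
exists j; split=> [i|i ji]; first by rewrite Wj i0_min.
rewrite lt_neqAle Wj i0_min // andbT; apply/negP => /eqP E.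
have : (i <= j)%N by apply: jmax; rewrite E.
by rewrite leqNgt ji.
Qed.

(** If the value of the sum exceeded the least value of its terms, then
    dividing by the last term attaining it would give a monic polynomial over
    [A] beating [g j]: the later terms have larger value, and the earlier
    coefficients become integral because [delta] is nondecreasing. *)
Lemma gauge_sum_le (a : 'I_n -> K) (j : 'I_n) :
  (forall i, w (a j *: ev (g j)) <= w (a i *: ev (g i)))%E ->
  (forall i : 'I_n, (j < i)%N -> w (a j *: ev (g j)) < w (a i *: ev (g i)))%E ->
  (w (\sum_i a i *: ev (g i)) <= w (a j *: ev (g j)))%E.
Proof.
have [->|aj0] := eqVneq (a j) 0; first by rewrite scale0r gauge0 leey.
set m := w (a j *: ev (g j)) => min_j last_j.
have [k ajk] := valuation_fin hval aj0.
have mE : m = (k%:~R + dl j)%:E by rewrite /m (gaugeZ_fin _ ajk) g_max -EFinD.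
rewrite leNgt; apply/negP => sum_gt.
pose tail := \sum_(i : 'I_n | (j < i)%N) a i *: ev (g i).
have tail_gt : (m < w tail)%E.
  apply: (ultra_sum_gt gauge0 (gauge_minD hw)); first by rewrite mE.
  by move=> i ji; apply: last_j.
pose head : {poly K} := \sum_(i : 'I_n | (i < j)%N) (a i / a j) *: g i.
pose h : {poly K} := g j + head.
have head_size : (size head <= j)%N.
  apply: (big_ind (fun p : {poly K} => size p <= j)%N).
  + by rewrite size_poly0.
  + by move=> x y sx sy; rewrite (leq_trans (size_polyD _ _)) // geq_max sx.
  + move=> i ij; apply: leq_trans (size_scale_leq _ _) _.
    by case: (g_mono i) => _ _ ->.
have h_mono : mono j h.
  case: (g_mono j) => gj_mon /polyOver_valringP gj_int gj_size; split.
  - by rewrite monicE lead_coefDl ?(monicP gj_mon) // gj_size ltnS.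
  - apply/polyOver_valringP => l; rewrite coefD coef_sum.
    apply: (subringD vA); [exact: gj_int | apply: (subring_sum vA) => i ij].
    rewrite coefZ; apply: (subringM vA) => /=; last first.
      by case: (g_mono i) => _ /polyOver_valringP.
    have [->|ai0] := eqVneq (a i) 0; first by rewrite mul0r (valuation0 hval) leey.
    have [c aic] := valuation_fin hval ai0.
    have := min_j i; rewrite mE (gaugeZ_fin _ aic) g_max -EFinD lee_fin => le.
    rewrite valuationM // aic (valuationV hval ajk) -EFinD lee_fin subr_ge0.
    rewrite -(ler_int rat); have := delta_mono (ltnW ij) (ltn_ord j); lra.
  - by rewrite size_polyDl gj_size.
have hE : a j *: ev h = \sum_i a i *: ev (g i) - tail.
  rewrite /h /head evalLD evalL_sum scalerDr scaler_sumr.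
  rewrite [in RHS](bigID (fun i : 'I_n => (j < i)%N)) /= -/tail [RHS]addrAC subrr add0r.
  rewrite [RHS](bigD1 j) ?ltnn //=; congr (_ + _); apply: eq_big => i.
    by rewrite -leqNgt ltn_neqAle andbC.
  by move=> _; rewrite scalerA mulrC divfK.
have : (m < w (a j *: ev h))%E.
  rewrite hE; apply: lt_le_trans (gauge_minD hw _ _).
  by rewrite lt_min sum_gt gaugeN.
have := delta_ge (ltn_ord j) h_mono.
rewrite (gaugeZ_fin _ ajk) mE; case: (w _) => [r||] //=.
by rewrite -EFinD lte_fin lee_fin; lra.
Qed.

(** This is reducedness of the family, before rescaling by powers of [pi]. *)
Lemma gauge_sum (a : 'I_n -> K) :
  w (\sum_i a i *: ev (g i)) = \big[Order.min/+oo%E]_i w (a i *: ev (g i)).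
Proof.
apply/eqP; rewrite eq_le; apply/andP; split.
  have [j [j_min j_last]] := last_argmin (fun i => w (a i *: ev (g i))).
  apply: le_trans (gauge_sum_le j_min j_last) _.
  by apply/bigmin_geP; split=> [|i _]; rewrite ?leey.
apply: (ultra_sum_ge gauge0 (gauge_minD hw)) => i _; exact: bigmin_le.
Qed.

Lemma gauge_sum_ge (a : 'I_n -> K) c i :
  (c <= w (\sum_i a i *: ev (g i)) -> c <= w (a i *: ev (g i)))%E.
Proof. by rewrite gauge_sum => /bigmin_geP[_]; apply. Qed.

Definition triangular_basis (j : 'I_n) : L :=
  pi ^ (- Num.floor (dl j)) *: ev (g j).
Local Notation b := triangular_basis.

Let scale_b (a : 'I_n -> K) j :
  a j *: b j = (a j * pi ^ (- Num.floor (dl j))) *: ev (g j).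
Proof. by rewrite scalerA. Qed.

Lemma triangular_basis_neq0 j : b j != 0.
Proof.
by rewrite scaler_eq0 negb_or expfz_neq0 ?(uniformizer_neq0 hv hpi) // ev_g_neq0.
Qed.

Lemma triangular_basis_reduced : is_reduced w b.
Proof.
split=> [j|a]; first exact: triangular_basis_neq0.
under eq_bigr do rewrite scale_b.
rewrite gauge_sum; by apply: eq_bigr => j _; rewrite scale_b.
Qed.

Lemma triangular_basis_integral : is_integral_basis v b.
Proof.
have vpi k : v (pi ^ k) = k%:E := valXz_uniformizer hv hpi k.
split.
- move=> j; apply/(gauge_integral hw).
  rewrite (gaugeZ_fin _ (vpi _)) g_max -EFinD lee_fin rmorphN addrC subr_ge0.
  exact: floor_le.
- move=> x /(gauge_integral hw) x_ge0; have [p sp pE] := evalL_surj x.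
  have [a aE _] := expansion (leqnn n) sp.
  exists (fun j => a j * pi ^ Num.floor (dl j)); split; last first.
    rewrite -pE aE evalL_sum; apply: eq_bigr => j _.
    rewrite scalerA -mulrA -expfzDr ?(uniformizer_neq0 hv hpi) //.
    by rewrite subrr expr0z mulr1.
  move=> j; rewrite inE; have [->|aj0] := eqVneq (a j) 0.
    by rewrite mul0r (valuation0 hval) leey.
  have [k ajk] := valuation_fin hval aj0.
  rewrite valuationM // ajk vpi -EFinD lee_fin -lerBlDl sub0r floor_ge_int.
  have : (0 <= w (a j *: ev (g j)))%E.
    by apply: gauge_sum_ge; rewrite -evalL_sum -aE pE.
  rewrite (gaugeZ_fin _ ajk) g_max -EFinD lee_fin rmorphN; lra.
- move=> a _ sum0 j; have [_ red] := triangular_basis_reduced.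
  have := red a; rewrite sum0 gauge0 => /esym min_y.
  have /(gauge_eqy hw)/eqP : w (a j *: b j) = +oo%E.
    by apply/eqP; rewrite -leye_eq -min_y; apply: bigmin_le.
  by rewrite scaler_eq0 (negPf (triangular_basis_neq0 j)) orbF => /eqP.
Qed.

Lemma absz_ceil_delta (i j : 'I_n) : (i <= j)%N ->
  (`|Num.ceil (dl j - dl i)|%N)%:Z = Num.ceil (dl j - dl i).
Proof.
move=> ij; rewrite gez0_abs // ceil_ge0; apply: lt_le_trans (_ : 0 <= _) => //.
by rewrite subr_ge0 delta_mono.
Qed.

(** The leading coefficient of [p] is that of the last term of its expansion
    along the family, whose value is at least that of [p] by reducedness. *)
Lemma gauge_le_lead (p : {poly K}) (i j : 'I_n) : (i < j)%N -> size p = i.+1 ->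
  ((dl j)%:E <= w (ev p))%E ->
  ((Posz `|Num.ceil (dl j - dl i)|%N)%:E <= v p`_i)%E.
Proof.
move=> ij sp le; have [|a pE a0] := @expansion p i.+1 (ltn_ord i).
  by rewrite sp.
have -> : p`_i = a i by rewrite pE expansion_top.
rewrite absz_ceil_delta ?(ltnW ij) //.
have [->|ai0] := eqVneq (a i) 0; first by rewrite (valuation0 hval) leey.
have [k aik] := valuation_fin hval ai0.
have : ((dl j)%:E <= w (a i *: ev (g i)))%E.
  by apply: gauge_sum_ge; rewrite -evalL_sum -pE.
rewrite (gaugeZ_fin _ aik) g_max -EFinD aik !lee_fin ceil_le_int; lra.
Qed.

End MaximalFamily.

(** * The normal form *)

Variable Rep : nat -> set K.
Hypothesis hRep : representatives v pi Rep.

Lemma Rep_exists d a : (0 <= v a)%E -> exists2 r, Rep d r & eqmod_pow v pi d a r.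
Proof.
move=> va; have [R0 Rd] := hRep; case: (posnP d) => [->|d0].
  by exists 0; [rewrite R0 | apply/(eqmod_powP hv hpi); rewrite subr0].
by have [_ /(_ a va)[r [[Rr E] _]]] := Rd d d0; exists r.
Qed.

Lemma Rep_uniq d r s : Rep d r -> Rep d s -> (d%:Z%:E <= v (r - s))%E -> r = s.
Proof.
have [R0 Rd] := hRep; case: (posnP d) => [->|d0]; first by rewrite R0 => -> ->.
move=> Rr Rs E; have [RA /(_ r (RA _ Rr))[c [_ c_uniq]]] := Rd d d0.
rewrite -(c_uniq r); last by split=> //; apply/(eqmod_powP hv hpi);
  rewrite subrr (valuation0 hval) leey.
by apply: c_uniq; split=> //; apply/(eqmod_powP hv hpi).
Qed.

Local Notation normal_coef h i j :=
  (Rep `|Num.ceil (dl j - dl i)|%N h`_i) (only parsing).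

(** Gaussian reduction from the top coefficient down: subtracting a multiple of
    [g i] of value at least [delta j] changes the coefficients of degree at
    most [i] only. *)
Lemma normal_polynomial_exists (j : 'I_n) :
  exists h, [/\ mono j h, w (ev h) = (dl j)%:E
    & forall i : 'I_n, (i < j)%N -> normal_coef h i j].
Proof.
have [g0 g0E mg0] : exists2 g0, mono j g0 & w (ev g0) = (dl j)%:E.
  by case: (deltaP (ltn_ord j)) => -[h]; exists h.
suff H m : (m <= j)%N -> exists h, [/\ mono j h, w (ev h) = (dl j)%:E
    & forall i : 'I_n, (j - m <= i < j)%N -> normal_coef h i j].
  have [h [mh hE hN]] := H j (leqnn _); exists h; split=> // i ij.
  by apply: hN; rewrite subnn.
elim: m => [|m IH] mj.
  by exists g0; split=> // i; rewrite subn0 => /andP[le lt]; lia.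
have [h [mh hE hN]] := IH (ltnW mj).
have lt_i0 : (j - m.+1 < n)%N by have := ltn_ord j; lia.
pose i0 := Ordinal lt_i0; have i0j : (i0 < j)%N by rewrite /=; lia.
have [[gi [gi_mon gi_int gi_size] giE] _] := deltaP lt_i0.
set d := `|Num.ceil (dl j - dl i0)|%N.
have h_int := mh; case: h_int => h_mon /polyOver_valringP h_int h_size.
have [r Rr /(eqmod_powP hv hpi) tr] := Rep_exists d (h_int i0).
pose c := h`_i0 - r; pose h' := h - c *: gi.
have size_c : (size (c *: gi) <= i0.+1)%N.
  by apply: leq_trans (size_scale_leq _ _) _; rewrite gi_size.
have c_int : (0 <= v c)%E by apply: le_trans tr; rewrite lee_fin.
have mh' : mono j h'.
  split.
  - rewrite monicE lead_coefDl ?(monicP h_mon) // size_polyN h_size.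
    by apply: leq_ltn_trans size_c _; rewrite ltnS.
  - apply/polyOver_valringP => l; rewrite coefB coefZ.
    apply: (subringB vA); [exact: h_int | apply: (subringM vA); first exact: c_int].
    by move/polyOver_valringP: gi_int => /=; apply.
  - rewrite size_polyDl // size_polyN h_size.
    by apply: leq_ltn_trans size_c _; rewrite ltnS.
exists h'; split=> //.
  apply/eqP; rewrite eq_le delta_ge ?ltn_ord //= /h' evalLB.
  apply: le_trans (gauge_minD hw _ _); rewrite le_min gaugeN hE lexx /=.
  rewrite evalLZ; have [->|c0] := eqVneq c 0; first by rewrite scale0r gauge0 leey.
  have [k ck] := valuation_fin hval c0; move: tr; rewrite -/c ck lee_fin.
  rewrite absz_ceil_delta ?(ltnW i0j) // ceil_le_int.
  by rewrite (gaugeZ_fin _ ck) giE -EFinD lee_fin /=; lra.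
move=> i /andP[le lt]; rewrite /h' coefB coefZ.
have [i0i|ii0|/val_inj i0i] := ltngtP i0 i.
- rewrite [gi`_i]nth_default ?gi_size // mulr0 subr0; apply: hN.
  by rewrite lt andbT; move: i0i => /=; lia.
- by move: ii0 le => /=; lia.
- have -> : gi`_i = 1 by move/monicP: gi_mon; rewrite lead_coefE gi_size -i0i.
  by rewrite mulr1 /c -i0i subKr.
Qed.

(** Otherwise the leading coefficient of [h - h'] is a nonzero difference of two
    representatives of the same class. *)
Lemma normal_polynomial_unique (j : 'I_n) (h h' : {poly K}) :
  mono j h -> mono j h' -> w (ev h) = (dl j)%:E -> w (ev h') = (dl j)%:E ->
  (forall i : 'I_n, (i < j)%N -> normal_coef h i j) ->
  (forall i : 'I_n, (i < j)%N -> normal_coef h' i j) -> h = h'.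
Proof.
move=> mh mh' hE hE' hN hN'; apply/eqP; rewrite -subr_eq0.
apply: contraT => D0; set D := h - h' in D0.
have /choice[g gP] (i : 'I_n) : exists p, mono i p /\ w (ev p) = (dl i)%:E.
  by case: (deltaP (ltn_ord i)) => -[p mp pE] _; exists p.
have sD : (size D <= j)%N.
  case: mh mh' => /monicP h1 _ sh [/monicP h1' _ sh'].
  apply/leq_sizeP => k; rewrite leq_eqVlt coefB => /orP[/eqP <-|jk].
    by move: h1 h1'; rewrite !lead_coefE sh sh' => -> ->; rewrite subrr.
  by rewrite !nth_default ?subrr ?sh ?sh'.
have sD0 : (0 < size D)%N by rewrite lt0n size_poly_eq0.
have lt_ij : ((size D).-1 < j)%N by rewrite prednK.
pose i := Ordinal (ltn_trans lt_ij (ltn_ord j)); have ij : (i < j)%N by [].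
have le : ((dl j)%:E <= w (ev D))%E.
  rewrite evalLB; apply: le_trans (gauge_minD hw _ _).
  by rewrite le_min gaugeN hE hE' lexx.
have sDi : size D = i.+1 by rewrite prednK.
have := gauge_le_lead (fun k => (gP k).1) (fun k => (gP k).2) ij sDi le.
rewrite coefB => /(Rep_uniq (hN i ij) (hN' i ij)) E.
by move: D0; rewrite -lead_coef_eq0 lead_coefE -[(size D).-1]/(val i) coefB E subrr eqxx.
Qed.

(** Row [i] of the coefficient matrix belongs to degree [n - 1 - i]: reindexing
    by [rev_ord] turns its entries above the diagonal into coefficients below
    the leading one. *)
Lemma normal_form_rows (g : 'I_n -> {poly K}) :
  reduced_normal_form v w theta Rep g <->
  forall i j : 'I_n, (i < j)%N -> normal_coef (g j) i j.
Proof.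
split=> h i j ij; last first.
  by rewrite mxE; apply: h; rewrite /=; have := ltn_ord j; lia.
have := h (rev_ord j) (rev_ord i); rewrite mxE !rev_ordK; apply => /=.
have := ltn_ord j; lia.
Qed.

Lemma unique_normal_basis : exists! b : 'I_n -> L, exists g : 'I_n -> {poly K},
  triangular_reduced_integral_basis v w theta pi g b /\
  reduced_normal_form v w theta Rep g.
Proof.
have /choice[g gP] := normal_polynomial_exists.
exists (triangular_basis g); split=> [|b' [g' [[_ _ mg' g'E bE]]]].
  have g_mono (j : 'I_n) : mono j (g j) by case: (gP j).
  have g_max (j : 'I_n) : w (ev (g j)) = (dl j)%:E by case: (gP j).
  exists g; split; last by apply/normal_form_rows => i j; case: (gP j) => _ _; apply.
  split; [exact: triangular_basis_integral | exact: triangular_basis_reduced | | |].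
  - exact: g_mono.
  - exact: g_max.
  - by [].
move=> /normal_form_rows g'N; apply/funext => j; rewrite bE /triangular_basis.
congr (_ *: ev _); case: (gP j) => mg gE gN.
by apply: (normal_polynomial_unique mg (mg' j) gE (g'E j) gN) => i; apply: g'N.
Qed.

End Triangular.

Theorem mainTheorem4 (K : fieldType) (v : K -> \bar int)
    (hv : is_normalized_discrete_valuation v)
    (pi : K) (hpi : is_uniformizer v pi)
    (L : fieldExtType K) (n : nat) (hn : (1 < n)%N)
    (hL : \dim {:L} = n)
    (f : {poly K}) (f_monic : f \is monic)
    (f_int : f \is a polyOver (valring v))
    (f_irr : irreducible_poly f) (f_deg : size f = n.+1)
    (theta : L) (f_root : root (map_poly (in_alg L) f) theta)
    (h_gen : (<<1; theta>> = {:L})%VS)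
    (B_fg : fg_over_valring v (integral_closure (L := L) v))
    (t : nat) (ws : 'I_t -> L -> \bar rat) (hws : lists_extensions v ws)
    (Rep : nat -> set K) (hRep : representatives v pi Rep) :
  exists! b : 'I_n -> L,
    exists g : 'I_n -> {poly K},
      triangular_reduced_integral_basis v (minval ws) theta pi g b /\
      reduced_normal_form v (minval ws) theta Rep g.
Proof.
apply: (unique_normal_basis hv hpi _ (minval_integral_gauge hv hpi hws)) => //.
- exact: fact_gt0.
- exact: ltnW.
- by exists f.
- by have := dim_Fadjoin 1%AS theta; rewrite h_gen hL dimv1 muln1.
Qed.
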